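(* Let $p$ be a prime. If a subgroup $G\subset\mathrm{PSL}(2,\mathbb{C}_p)$ contains only the unit element and loxodromic elements (that is, every non-identity element of $G$ is loxodromic), then $G$ is a discrete subgroup.
   Context: $\mathbb{C}_p$ is the completion of the algebraic closure of $\mathbb{Q}_p$. $\mathrm{PSL}(2,\mathbb{C}_p)=\mathrm{SL}(2,\mathbb{C}_p)/\{\pm I\}$. An element is loxodromic if at least one of its eigenvalues has absolute value larger than $1$. For a matrix, $\|(a_{ij})\|=\max_{i,j}|a_{ij}|$. For $g,h\in\mathrm{PSL}(2,\mathbb{C}_p)$ with lifts $g_1,g_2$ and $h_1,h_2$ in $\mathrm{SL}(2,\mathbb{C}_p)$, $\|g-h\|=\inf_{1\le i\le2,\,1\le j\le2}\|g_i-h_j\|$. A subgroup $G$ of $\mathrm{PSL}(2,\mathbb{C}_p)$ is called discrete if there exists $\varepsilon>0$ such that $\|g-I\|>\varepsilon$ for every non-identity element $g\in G$. *)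

(* Defs.v *)
From HB Require Import structures.
From mathcomp Require Import all_boot all_order all_algebra.
From mathcomp Require Import classical_sets reals.

Set Implicit Arguments.
Unset Strict Implicit.
Unset Printing Implicit Defensive.

Import Order.TTheory GRing.Theory Num.Theory.

Local Open Scope ring_scope.
Local Open Scope quotient_scope.

Section AbsoluteValues.
Variable R : realType.

Record is_nonarch_absval (K : fieldType) (v : K -> R) : Prop :=
  IsNonarchAbsval {
    absval_ge0 : forall x, 0 <= v x;
    absval_eq0 : forall x, (v x == 0) = (x == 0);
    absvalM : {morph v : x y / x * y};
    absvalD_max : forall x y, v (x + y) <= Num.max (v x) (v y)
  }.

Definition absval_cvg (K : fieldType) (v : K -> R) (u : nat -> K) (l : K) :
    Prop :=
  forall e : R, 0 < e ->
    exists N, forall n, (N <= n)%N -> v (u n - l) < e.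

Definition absval_cauchy (K : fieldType) (v : K -> R) (u : nat -> K) : Prop :=
  forall e : R, 0 < e ->
    exists N, forall m n, (N <= m)%N -> (N <= n)%N -> v (u m - u n) < e.

Definition absval_complete (K : fieldType) (v : K -> R) : Prop :=
  forall u, absval_cauchy v u -> exists l, absval_cvg v u l.

Definition is_completion (F K : fieldType) (vF : F -> R) (vK : K -> R)
    (i : {rmorphism F -> K}) : Prop :=
  [/\ is_nonarch_absval vK,
      forall x, vK (i x) = vF x,
      forall y (e : R), 0 < e -> exists x, vK (y - i x) < e
    & absval_complete vK].

Definition is_algebraic_closure (F L : fieldType) (j : {rmorphism F -> L}) :
    Prop :=
  GRing.closed_field_axiom L /\ (forall x : L, algebraicOver j x).

Definition padic_abs (p : nat) (x : rat) : R :=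
  if x == 0 then 0
  else p%:R ^+ logn p `|denq x|%N / p%:R ^+ logn p `|numq x|%N.

(* (C, v) is the field of p-adic complex numbers with its absolute value:
   Q -> Qp is a completion for the p-adic absolute value, Qp -> Qpbar an
   algebraic closure with an absolute value extending that of Qp, and
   Qpbar -> C a completion.  These properties determine (C, v) up to isometric
   isomorphism, so a statement about all such (C, v) is one about C_p. *)
Definition is_Cp (p : nat) (C : fieldType) (v : C -> R) : Prop :=
  exists (Qp Qpbar : fieldType) (vp : Qp -> R) (vbar : Qpbar -> R)
         (i : {rmorphism rat -> Qp}) (j : {rmorphism Qp -> Qpbar})
         (k : {rmorphism Qpbar -> C}),
    [/\ is_completion (padic_abs p) vp i,
        is_algebraic_closure j,
        is_nonarch_absval vbar,
        forall x, vbar (j x) = vp x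
      & is_completion vbar v k].

End AbsoluteValues.

Section PSL2.
Variable K : fieldType.

Record SL2 : Type := MkSL2 { slval :> 'M[K]_2; slvalP : \det slval == 1 }.

HB.instance Definition _ := [isSub for slval].
HB.instance Definition _ := [Choice of SL2 by <:].

Implicit Types A B : SL2.

Fact SL2_one_subproof : \det (1%:M : 'M[K]_2) == 1.
Proof. by rewrite det1. Qed.

Fact SL2_mul_subproof A B : \det (slval A *m slval B) == 1.
Proof. by rewrite det_mulmx (eqP (slvalP A)) (eqP (slvalP B)) mul1r. Qed.

Fact SL2_inv_subproof A : \det (invmx (slval A)) == 1.
Proof. by rewrite det_inv (eqP (slvalP A)) invr1. Qed.

Definition SL2_one := MkSL2 SL2_one_subproof.
Definition SL2_mul A B := MkSL2 (SL2_mul_subproof A B).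
Definition SL2_inv A := MkSL2 (SL2_inv_subproof A).

Fact SL2_unitmx A : slval A \in unitmx.
Proof. by rewrite unitmxE (eqP (slvalP A)) unitr1. Qed.

Fact SL2_mulA : associative SL2_mul.
Proof. by move=> A B C; apply: val_inj; rewrite /= mulmxA. Qed.

Fact SL2_mul1 : left_id SL2_one SL2_mul.
Proof. by move=> A; apply: val_inj; rewrite /= mul1mx. Qed.

Fact SL2_mulr1 : right_id SL2_one SL2_mul.
Proof. by move=> A; apply: val_inj; rewrite /= mulmx1. Qed.

Fact SL2_mulV : left_inverse SL2_one SL2_inv SL2_mul.
Proof. by move=> A; apply: val_inj; rewrite /= mulVmx ?SL2_unitmx. Qed.

Fact SL2_mulrV : right_inverse SL2_one SL2_inv SL2_mul.
Proof. by move=> A; apply: val_inj; rewrite /= mulmxV ?SL2_unitmx. Qed.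

HB.instance Definition _ :=
  isGroup.Build SL2 SL2_mulA SL2_mul1 SL2_mulr1 SL2_mulV SL2_mulrV.

Definition eq_up_to_sign A B : bool :=
  (slval A == slval B) || (slval A == - slval B).

Fact eq_up_to_sign_refl : reflexive eq_up_to_sign.
Proof. by move=> A; rewrite /eq_up_to_sign eqxx. Qed.

Fact eq_up_to_sign_sym : symmetric eq_up_to_sign.
Proof.
move=> A B; rewrite /eq_up_to_sign; congr (_ || _); first exact: eq_sym.
by rewrite -eqr_oppLR eq_sym.
Qed.

Fact eq_up_to_sign_trans : transitive eq_up_to_sign.
Proof.
move=> B A C; rewrite /eq_up_to_sign.
by move=> /orP[]/eqP-> /orP[]/eqP->; rewrite ?opprK eqxx ?orbT.
Qed.

Canonical eq_up_to_sign_equiv :=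
  EquivRel eq_up_to_sign
    eq_up_to_sign_refl eq_up_to_sign_sym eq_up_to_sign_trans.

Definition PSL2 := {eq_quot eq_up_to_sign}.

HB.instance Definition _ := Choice.on PSL2.
HB.instance Definition _ := EqQuotient.on PSL2.

Definition PSL2_one : PSL2 := \pi_PSL2 (1%g : SL2).
Definition PSL2_mul (g h : PSL2) : PSL2 := \pi_PSL2 (repr g * repr h)%g.
Definition PSL2_inv (g : PSL2) : PSL2 := \pi_PSL2 (repr g)^-1%g.

Fact PSL2_pi_eq A B :
  (\pi_PSL2 A = \pi_PSL2 B) <-> (slval A = slval B \/ slval A = - slval B).
Proof.
split=> [/eqmodP /orP[]/eqP->|h]; [by left|by right|].
by apply/eqmodP/orP; case: h => ->; rewrite eqxx; [left|right].
Qed.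

Fact PSL2_repr_pi A :
  slval (repr (\pi_PSL2 A)) = slval A \/ slval (repr (\pi_PSL2 A)) = - slval A.
Proof. by apply/PSL2_pi_eq; rewrite reprK. Qed.

Fact PSL2_pi_mul A B :
  PSL2_mul (\pi_PSL2 A) (\pi_PSL2 B) = \pi_PSL2 (A * B)%g.
Proof.
apply/PSL2_pi_eq => /=.
have [->|->] := PSL2_repr_pi A; have [->|->] := PSL2_repr_pi B;
  rewrite ?mulmxN ?mulNmx ?opprK; by [left|right].
Qed.

Fact PSL2_pi_inv A : PSL2_inv (\pi_PSL2 A) = \pi_PSL2 A^-1%g.
Proof.
apply/PSL2_pi_eq => /=; have [->|->] := PSL2_repr_pi A; first by left.
right; rewrite -scaleN1r invmxZ ?invrN1 ?scaleN1r //.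
by rewrite -scaleN1r unitmxZ ?unitrN1 ?SL2_unitmx.
Qed.

Fact PSL2_mulA : associative PSL2_mul.
Proof.
elim/quotW=> A; elim/quotW=> B; elim/quotW=> D.
by rewrite (PSL2_pi_mul A B) (PSL2_pi_mul B D) !PSL2_pi_mul mulgA.
Qed.

Fact PSL2_mul1 : left_id PSL2_one PSL2_mul.
Proof. by elim/quotW=> A; rewrite PSL2_pi_mul mul1g. Qed.

Fact PSL2_mulr1 : right_id PSL2_one PSL2_mul.
Proof. by elim/quotW=> A; rewrite PSL2_pi_mul mulg1. Qed.

Fact PSL2_mulV : left_inverse PSL2_one PSL2_inv PSL2_mul.
Proof. by elim/quotW=> A; rewrite PSL2_pi_inv PSL2_pi_mul mulVg. Qed.

Fact PSL2_mulrV : right_inverse PSL2_one PSL2_inv PSL2_mul.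
Proof. by elim/quotW=> A; rewrite PSL2_pi_inv PSL2_pi_mul mulgV. Qed.

HB.instance Definition _ :=
  isGroup.Build PSL2 PSL2_mulA PSL2_mul1 PSL2_mulr1 PSL2_mulV PSL2_mulrV.

End PSL2.

Section Discrete.
Variables (R : realType) (C : fieldType) (v : C -> R).

(* The default 0 of the maximum is harmless: v is nonnegative. *)
Definition mat_norm (A : 'M[C]_2) : R :=
  \big[Num.max/0]_(i < 2) \big[Num.max/0]_(j < 2) v (A i j).

Definition PSL2_dist (g h : PSL2 C) : R :=
  inf [set r : R | exists A B : SL2 C,
    [/\ \pi_(PSL2 C) A = g, \pi_(PSL2 C) B = h
      & r = mat_norm (slval A - slval B)]].

(* The two lifts of g are opposite, so the absolute values of the eigenvalues
   do not depend on the lift. *)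
Definition loxodromic (g : PSL2 C) : Prop :=
  exists (A : SL2 C) (a : C),
    [/\ \pi_(PSL2 C) A = g, eigenvalue (slval A) a & 1 < v a].

Definition discrete (G : {pred PSL2 C}) : Prop :=
  exists2 e : R, 0 < e &
    forall g, g \in G -> g != 1%g -> e < PSL2_dist g 1%g.

End Discrete.

(* Main.v *)
Require Import Defs.
From mathcomp Require Import all_boot all_order all_algebra.
From mathcomp Require Import classical_sets reals.

(** A nonarchimedean absolute value bounds the eigenvalues of a matrix by its
    entries: the matrices with entries in the closed unit ball have all their
    eigenvalues in the unit ball ([eigenvalue_absval_le1]).  If a lift [A] of
    [g] were at distance at most 1 from a lift of the identity, then by the
    ultrametric inequality the entries of [A], like those of [I] and [- I],
    would have absolute value at most 1; hence neither [A] nor [- A] could have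
    an eigenvalue outside the unit ball, and [g] would not be loxodromic.  So
    every loxodromic element is at distance at least 1 from the identity
    ([PSL2_dist_loxodromic_ge1]), and any constant below 1 witnesses
    discreteness. *)

Import Order.TTheory GRing.Theory Num.Theory.

Local Open Scope ring_scope.
Local Open Scope quotient_scope.

Section NonarchimedeanAbsoluteValue.
Variables (R : realType) (K : fieldType) (v : K -> R).
Hypothesis v_abs : is_nonarch_absval v.

Lemma absval1 : v 1 = 1.
Proof.
have v1N0 : v 1 != 0 by rewrite (absval_eq0 v_abs) oner_neq0.
by apply: (mulfI v1N0); rewrite -(absvalM v_abs) !mulr1.
Qed.

Lemma absvalN x : v (- x) = v x.
Proof.
(* Squaring loses no information, since both sides are nonnegative. *)
apply/eqP; rewrite -(@eqrXn2 _ 2) ?(absval_ge0 v_abs) //.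
by rewrite !expr2 -!(absvalM v_abs) mulrNN.
Qed.

Lemma absvalD_le x y r : v x <= r -> v y <= r -> v (x + y) <= r.
Proof.
by move=> xr yr; apply: le_trans (absvalD_max v_abs x y) _; rewrite ge_max xr.
Qed.

Lemma absval_sum_le (I : finType) (F : I -> K) r :
  0 <= r -> (forall i, v (F i) <= r) -> v (\sum_i F i) <= r.
Proof.
move=> r0 Fr; elim/big_ind: _ => // [|x y]; last exact: absvalD_le.
by have /eqP -> : v 0 == 0 by rewrite (absval_eq0 v_abs).
Qed.

(** At a coordinate where an eigenvector [u] has maximal absolute value, the
    ultrametric inequality gives [v a * v (u i) <= v (u i)]. *)
Lemma eigenvalue_absval_le1 n (A : 'M[K]_n) a :
  (forall i j, v (A i j) <= 1) -> eigenvalue A a -> v a <= 1.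
Proof.
move=> A1 /eigenvalueP[u uA /rV0Pn[i0 ui0]].
have [i _ u_max] := arg_maxP (fun i => v (u 0 i)) (erefl : xpredT i0).
have ui_gt0 : 0 < v (u 0 i).
  apply: lt_le_trans (u_max i0 isT).
  by rewrite lt0r (absval_eq0 v_abs) ui0 (absval_ge0 v_abs).
rewrite -(ler_pM2r ui_gt0) mul1r -(absvalM v_abs).
have -> : a * u 0 i = \sum_j u 0 j * A j i.
  by have /rowP/(_ i) := uA; rewrite !mxE.
apply: absval_sum_le => [|j]; first exact: ltW.
rewrite (absvalM v_abs); apply: le_trans (u_max j isT).
by rewrite ler_piMr ?(absval_ge0 v_abs).
Qed.

Lemma absval_le_mat_norm (A : 'M[K]_2) i j : v (A i j) <= mat_norm v A.
Proof.
apply: le_trans (le_bigmax _ (fun i => \big[Num.max/0]_j v (A i j)) i).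
exact: (le_bigmax _ (fun j => v (A i j))).
Qed.

Lemma lift_one_absval_le1 (B : SL2 K) i j :
  \pi_(PSL2 K) B = 1%g -> v (slval B i j) <= 1.
Proof.
have I1 : v ((1%:M : 'M[K]_2) i j) <= 1.
  rewrite mxE; case: (i == j); first by rewrite absval1.
  by have /eqP -> : v 0 == 0 by rewrite (absval_eq0 v_abs).
by case/PSL2_pi_eq => -> //; rewrite mxE absvalN.
Qed.

(** The bound is 1 because the closed unit ball of matrices is stable under
    addition and contains the lifts of the identity: a lift [A'] of [g] closer
    than 1 to one of them lies in that ball.  The lift [A] carrying the
    eigenvalue may be the opposite of [A'], which has entries of the same
    absolute value. *)
Lemma PSL2_dist_loxodromic_ge1 (g : PSL2 K) :
  loxodromic v g -> 1 <= PSL2_dist v g 1%g.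
Proof.
move=> [A [a [piA Aa a_gt1]]]; apply: lb_le_inf.
  (* The infimum of the empty set is 0 by convention: [g] must have a lift. *)
  by exists (mat_norm v (slval A - 1%:M)), A, 1%g.
move=> _ [A' [B [piA' piB ->]]]; rewrite leNgt; apply/negP => near.
have A'1 i j : v (slval A' i j) <= 1.
  rewrite -[slval A'](subrK (slval B)) mxE.
  apply: absvalD_le; last exact: lift_one_absval_le1.
  exact: le_trans (absval_le_mat_norm _ i j) (ltW near).
have A1 i j : v (slval A i j) <= 1.
  have : \pi_(PSL2 K) A = \pi_(PSL2 K) A' by rewrite piA.
  by case/PSL2_pi_eq => ->; rewrite // mxE absvalN.
by have := eigenvalue_absval_le1 _ _ _ A1 Aa; rewrite leNgt a_gt1.
Qed.

End NonarchimedeanAbsoluteValue.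

Theorem corollary1p11 (R : realType) (p : nat) (p_prime : prime p)
    (Cp : fieldType) (v : Cp -> R) (HCp : is_Cp p v)
    (G : {pred PSL2 Cp}) (G_subgroup : group_closed G)
    (G_loxodromic : forall g, g \in G -> g != 1%g -> loxodromic v g) :
  discrete v G.
Proof.
have [Qp [Qpbar [vp [vbar [i [j [k [_ _ _ _ [v_abs _ _ _]]]]]]]]] := HCp.
exists 2^-1 => [|g gG g1]; first by rewrite invr_gt0 ltr0n.
have g_far := PSL2_dist_loxodromic_ge1 _ _ _ v_abs _ (G_loxodromic g gG g1).
apply: lt_le_trans g_far.
by rewrite invf_lt1 ?ltr0n ?ltr1n.
Qed.
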